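(* Let $G$ be a connected graph with $n(G)\ge 5$. Then $\dim_l(G)=n(G)-3$ if and only if one of the following holds: (i) $\omega(G)=n(G)-2$ and $G$ is $\{\Gamma_1,\Gamma_2\}$-free; (ii) $G\cong C_5$; (iii) $G\cong K_{n(G)}^{-}(\lambda,\mu)$ for some integers $\lambda\ge\mu\ge 2$ with $\lambda+\mu<n(G)$.
   Context: All graphs are finite and simple. $n(G)$ is the number of vertices and $\omega(G)$ the clique number of $G$. For vertices $x,y$ of a connected graph $G$, $d_G(x,y)$ is the length of a shortest $x,y$-path. A vertex $w$ distinguishes vertices $u,v$ if $d_G(u,w)\neq d_G(v,w)$. A set $W\subseteq V(G)$ is a local resolving set of $G$ if for every pair of adjacent vertices $u,v\in V(G)\setminus W$ some vertex of $W$ distinguishes $u$ and $v$. The local metric dimension $\dim_l(G)$ is the minimum cardinality of a local resolving set of $G$. For $n\ge 3$ and $1\le\mu\le\lambda$ with $\lambda+\mu\le n-1$, $K_n^{-}(\lambda,\mu)$ denotes the graph obtained from $K_n$ by deleting all edges of a subgraph isomorphic to $K_{\lambda,\mu}$. $\Gamma_1$ is the graph with vertex set $\{v_1,\dots,v_6\}$ and edge set $\{v_iv_j: i\ne j,\ i,j\in\{1,2,3,4\}\}\cup\{v_1v_5,v_1v_6,v_2v_5,v_3v_6\}$; $\Gamma_2$ is obtained from $\Gamma_1$ by adding the edge $v_5v_6$. A graph is $\{\Gamma_1,\Gamma_2\}$-free if it has no induced subgraph isomorphic to $\Gamma_1$ or to $\Gamma_2$. *)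

(* Defs.v *)
From mathcomp Require Import all_boot.
Set Implicit Arguments. Unset Strict Implicit. Unset Printing Implicit Defensive.

Section Graphs.
Variable T : finType.
Variable g : rel T.

Definition simple_graph : Prop := symmetric g /\ irreflexive g.

Definition connected_graph : Prop := forall x y : T, connect g x y.

Definition walkn (k : nat) (x y : T) : bool :=
  [exists p : k.-tuple T, path g x p && (last x p == y)].

(* d_G(x,y): the least k with a walk (hence a path) of length k from x to y;
   for connected graphs this is < #|T|.  (Value #|T| if unreachable.) *)
Definition dist (x y : T) : nat :=
  find (fun k => walkn k x y) (iota 0 #|T|).

Definition distinguishes (w u v : T) : bool := dist u w != dist v w.

Definition local_resolving (W : {set T}) : bool :=
  [forall u, forall v,
     [&& u \notin W, v \notin W & g u v] ==>
     [exists w in W, distinguishes w u v]].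

(* local metric dimension: minimum cardinality of a local resolving set
   (setT is always local resolving, vacuously) *)
Definition ldim : nat :=
  #|[arg min_(W < [set: T] | local_resolving W) #|W|]|.

Definition is_clique (S : {set T}) : bool :=
  [forall x in S, forall y in S, (x != y) ==> g x y].

Definition omega : nat := \max_(S : {set T} | is_clique S) #|S|.

End Graphs.

Definition isomorphic (T' : finType) (g' : rel T') (T : finType) (g : rel T) : Prop :=
  exists f : T' -> T, bijective f /\ forall x y, g (f x) (f y) = g' x y.

Definition induced_sub (T' : finType) (h : rel T') (T : finType) (g : rel T) : Prop :=
  exists f : T' -> T, injective f /\ forall x y, g (f x) (f y) = h x y.

(* Gamma_1 on vertices v_1..v_6, encoded as indices 0..5 of 'I_6 *)
Definition gamma1_pair (a b : nat) : bool :=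
  [|| (a < 4) && (b < 4),
      (a == 0) && (b == 4), (a == 0) && (b == 5),
      (a == 1) && (b == 4) | (a == 2) && (b == 5)].

Definition Gamma1 : rel 'I_6 := fun i j =>
  (i != j) && (gamma1_pair i j || gamma1_pair j i).

Definition Gamma2 : rel 'I_6 := fun i j =>
  (i != j) && [|| gamma1_pair i j, gamma1_pair j i,
                  (val i == 4) && (val j == 5) | (val i == 5) && (val j == 4)].

Definition C5 : rel 'I_5 := fun i j =>
  (j == (i + 1) %% 5 :> nat) || (i == (j + 1) %% 5 :> nat).

Definition Kminus (n lam mu : nat) : rel 'I_n := fun i j =>
  let inA (k : 'I_n) := k < lam in
  let inB (k : 'I_n) := (lam <= k) && (k < lam + mu) in
  (i != j) && ~~ ((inA i && inB j) || (inB i && inA j)).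
Arguments Kminus : clear implicits.

(* Main.v *)
(** Call a set of vertices good if each of its edges is distinguished by a vertex outside
    it: [ldim g <= n - k] iff there is a good set of size [k], so the theorem describes the
    graphs having a good 3-set but no good 4-set.

    If the distances to a vertex [a] reach 4, one vertex at each of the distances 1, ..., 4
    gives a good set; if they reach 3, the distance levels of [a] and of a vertex opposite
    to it force a good 4-set or a clique of size [n - 2].  In diameter at most 2,
    adjacency alone distinguishes.  If moreover [omega g <= n - 3], every two
    vertices are avoided by some non-edge; starting from an induced 3K1, P4 or C4, one keeps
    adding common neighbours of non-adjacent vertices, or the vertices of such non-edges, and
    a small exhaustive search shows that a good 4-set always shows up, except in C5.
    So all other graphs have no induced 3K1, P4 or C4, that is, their complement is a
    complete bipartite graph plus isolated vertices.

    Next to a clique of size [n - 2], with [x] and [y] the remaining vertices, four vertices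
    are pairwise distinguished only if the parities of their distances to [x] and [y] take
    all four values, which yields [Gamma1] or [Gamma2]. *)

Require Import Defs.
From mathcomp Require Import all_boot zify.
Set Implicit Arguments. Unset Strict Implicit. Unset Printing Implicit Defensive.

(** * Search over partial adjacency matrices *)

(* Row [i] of a matrix lists the adjacencies of vertex [i] to the vertices [j < i]. *)
Definition adj (M : seq (seq bool)) i j :=
  if j < i then nth false (nth [::] M i) j
  else if i < j then nth false (nth [::] M j) i else false.

Fixpoint combs q (l : seq nat) : seq (seq nat) :=
  match q, l with
  | 0, _ => [:: [::]]
  | _, [::] => [::]
  | q'.+1, i :: l' => map (cons i) (combs q' l') ++ combs q l'
  end.

Fixpoint bitseqs k : seq bitseq :=
  if k is k'.+1 then map (cons true) (bitseqs k') ++ map (cons false) (bitseqs k')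
  else [:: [::]].

(* [vm_compute] evaluates both sides of [||], hence [has]; [find] stops at the first hit. *)
Definition lazy_has (A : Type) (a : pred A) s := find a s < size s.

(** Only adjacency to vertices already in the matrix counts, so a set resolved here stays good in
    every graph containing the matrix as an induced subgraph. *)
Definition unresolved M (s : seq nat) u v :=
  if adj M u v then
    ~~ lazy_has (fun w => (w \notin s) && (adj M u w != adj M v w)) (iota 0 (size M))
  else false.

Definition resolved M s := ~~ lazy_has (fun u => lazy_has (unresolved M s u) s) s.

Definition has_resolved q M := lazy_has (resolved M) (combs q (iota 0 (size M))).

Definition index_pairs n := [seq (i, j) | i <- iota 0 n, j <- iota 0 i.+1].

(** In diameter two such a pair has a common neighbour, which must be a vertex outside the
    matrix. *)
Definition distant M (p : nat * nat) :=
  [&& p.1 != p.2, ~~ adj M p.1 p.2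
    & ~~ has (fun k => adj M p.1 k && adj M p.2 k) (iota 0 (size M))].

Definition off_pair (p : nat * nat) i := (i != p.1) && (i != p.2).

(** Any non-edge avoiding [p] then has an end outside the matrix. For [b] false, [p] is a repeated
    index and stands for a single vertex. *)
Definition covers b M (p : nat * nat) :=
  (b == (p.1 != p.2)) &&
  all (fun i => all (fun j => [&& off_pair p i, off_pair p j & i != j] ==> adj M i j)
    (iota 0 (size M))) (iota 0 (size M)).

Definition common_nbr_extensions M (p : nat * nat) :=
  [seq rcons M m | m <- bitseqs (size M) & nth false m p.1 && nth false m p.2].

(** Row [m] belongs to an end of the non-edge that is new. If it is adjacent to everything off [p],
    the other end is new as well and gets its own row, whose last entry [false] records the
    non-edge. *)
Definition nonedge_extensions M (p : nat * nat) :=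
  flatten [seq if all (fun i => off_pair p i ==> nth false m i) (iota 0 (size M))
               then [seq rcons (rcons M m) (rcons m' false) | m' <- bitseqs (size M)]
               else [:: rcons M m] | m <- bitseqs (size M)].

Definition C5_labelling M (l : seq nat) :=
  all (fun i => all (fun j => adj M (nth 0 l i) (nth 0 l j) ==
    ((j == (i + 1) %% 5) || (i == (j + 1) %% 5))) (iota 0 5)) (iota 0 5).

Definition is_C5 M := (size M == 5) && has (C5_labelling M) (permutations (iota 0 5)).

(* [b] tells whether every two vertices, or only every single vertex, are avoided
   by some non-edge of the graph; [q] is the cardinality of the forbidden sets. *)
Fixpoint search b q fuel M :=
  if has_resolved q M then true else
  if fuel is fuel'.+1 then
    if [seq p <- index_pairs (size M) | distant M p] is p :: _ then
      all (search b q fuel') (common_nbr_extensions M p)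
    else if [seq p <- index_pairs (size M) | covers b M p] is p :: _ then
      all (search b q fuel') (nonedge_extensions M p)
    else if is_C5 M then all (search b q fuel') [seq rcons M m | m <- bitseqs (size M)]
    else false
  else false.

(** This run starts from a single non-edge and looks for good sets of size 3; the next three start
    from the induced subgraphs to be excluded and look for size 4. *)
Lemma search_nonedge : search false 3 3 [:: [::]; [:: false]].
Proof. by vm_compute. Qed.

Lemma search_3K1 : search true 4 4 [:: [::]; [:: false]; [:: false; false]].
Proof. by vm_compute. Qed.

Lemma search_P4 :
  search true 4 4 [:: [::]; [:: true]; [:: false; true]; [:: false; false; true]].
Proof. by vm_compute. Qed.

Lemma search_C4 :
  search true 4 4 [:: [::]; [:: true]; [:: false; true]; [:: true; false; true]].
Proof. by vm_compute. Qed.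

Lemma lazy_hasE (A : Type) (a : pred A) s : lazy_has a s = has a s.
Proof. by rewrite /lazy_has has_find. Qed.

Lemma combsP q l s : s \in combs q l -> subseq s l /\ size s = q.
Proof.
elim: l q s => [|i l IHl] [|q] s //=.
- by rewrite inE => /eqP->.
- by rewrite inE => /eqP->.
rewrite mem_cat => /orP[/mapP[t /IHl[st <-] ->] | /IHl[sl <-]].
  by rewrite /= eqxx.
by split=> //; apply: subseq_trans sl (subseq_cons l i).
Qed.

Lemma mem_bitseqs m : m \in bitseqs (size m).
Proof.
elim: m => [|b m IHm] //=; rewrite mem_cat.
by case: b; rewrite map_f ?orbT.
Qed.

Lemma ex_notin (T : finType) (s : seq T) : size s < #|T| -> exists x, x \notin s.
Proof.
move=> lt; apply/existsP; apply: contraTT lt => /existsPn h; rewrite -leqNgt.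
apply: leq_trans (card_size s); apply/subset_leq_card/subsetP=> x _.
by have := h x; rewrite negbK.
Qed.

(** * Distances and good sets *)

Section Graph.
Variables (T : finType) (g : rel T).
Hypotheses (gsym : symmetric g) (girr : irreflexive g) (gconn : connected_graph g).
Implicit Types (x y z u v w : T) (s : seq T).

Lemma walknP k x y :
  reflect (exists p, [/\ size p = k, path g x p & last x p = y]) (walkn g k x y).
Proof.
apply: (iffP existsP) => [[p /andP[gp /eqP lp]] | [p [sp gp lp]]].
  by exists p; rewrite size_tuple.
by have sp' : size p == k by [apply/eqP]; exists (Tuple sp'); rewrite gp lp eqxx.
Qed.

Lemma walkn_add k l x y z : walkn g k x y -> walkn g l y z -> walkn g (k + l) x z.
Proof.
move=> /walknP[p [<- gp lp]] /walknP[q [<- gq lq]]; apply/walknP; exists (p ++ q).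
by rewrite size_cat cat_path last_cat lp gp gq lq.
Qed.

Lemma walkn1 x y : walkn g 1 x y = g x y.
Proof.
apply/walknP/idP => [[p [sp gp <-]] | gxy].
  by case: p sp gp => [|z []] //= _ /andP[].
by exists [:: y]; rewrite /= gxy.
Qed.

Lemma walknS k x y : walkn g k.+1 x y -> exists2 z, g x z & walkn g k z y.
Proof.
case/walknP=> p []; case: p => [|z p] //= [sp] /andP[gz gp] lp; exists z => //.
by apply/walknP; exists p.
Qed.

Lemma walkn_sym k x y : walkn g k x y -> walkn g k y x.
Proof.
elim: k x y => [|k IHk] x y.
  by case/walknP=> p [/size0nil -> _ /= <-]; apply/walknP; exists [::].
case/walknS=> z gz /IHk w; rewrite -addn1; apply: walkn_add w _.
by rewrite walkn1 gsym.
Qed.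

Lemma walkn_dist x y : walkn g (dist g x y) x y && (dist g x y < #|T|).
Proof.
have /connectP[p0 gp0 yE] := gconn x y.
have hasw : has (fun k => walkn g k x y) (iota 0 #|T|).
  (* A walk shortened to a path has distinct vertices, so its length lies in the range below [#|T|]
     that [dist] searches. *)
  case: (shortenP gp0) yE => p gp up _ yE.
  apply/hasP; exists (size p); last by apply/walknP; exists p.
  by rewrite mem_iota /= add0n; have := max_card (mem (x :: p)); rewrite (card_uniqP up).
have lt : dist g x y < #|T| by move: hasw; rewrite has_find size_iota.
by rewrite lt; have := nth_find 0 hasw; rewrite nth_iota // add0n => ->.
Qed.

Lemma dist_le k x y : walkn g k x y -> dist g x y <= k.
Proof.
move=> wk; rewrite leqNgt; apply/negP => lt.
have := before_find 0 lt; rewrite nth_iota ?wk //.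
by apply: ltn_trans lt _; case/andP: (walkn_dist x y).
Qed.

Lemma distC x y : dist g x y = dist g y x.
Proof.
have h u v : dist g u v <= dist g v u.
  by apply/dist_le/walkn_sym; case/andP: (walkn_dist v u).
by apply/eqP; rewrite eqn_leq !h.
Qed.

Lemma dist_triangle x y z : dist g x z <= dist g x y + dist g y z.
Proof.
apply/dist_le/(@walkn_add _ _ _ y).
  by case/andP: (walkn_dist x y).
by case/andP: (walkn_dist y z).
Qed.

Lemma dist_eq0 x y : (dist g x y == 0) = (x == y).
Proof.
apply/eqP/eqP => [d0 | ->]. 
  by have /andP[] := walkn_dist x y; rewrite d0 => /walknP[p [/size0nil -> _ /= ->]].
by apply/eqP; rewrite -leqn0; apply: dist_le; apply/walknP; exists [::].
Qed.

Lemma distxx x : dist g x x = 0.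
Proof. by apply/eqP; rewrite dist_eq0. Qed.

Lemma dist_gt0 x y : (0 < dist g x y) = (x != y).
Proof. by rewrite lt0n dist_eq0. Qed.

Lemma dist_eq1 x y : (dist g x y == 1) = g x y.
Proof.
apply/eqP/idP => [d1 | gxy].
  by have /andP[] := walkn_dist x y; rewrite d1 walkn1.
apply/eqP; rewrite eqn_leq dist_le ?walkn1 // dist_gt0.
by apply: contraTneq gxy => ->; rewrite girr.
Qed.

Lemma dist_adj x y : g x y -> dist g x y = 1.
Proof. by rewrite -dist_eq1 => /eqP. Qed.

Lemma dist_adj_le x y z : g x y -> dist g x z <= (dist g y z).+1.
Proof. by move=> gxy; rewrite -add1n -(dist_adj gxy) dist_triangle. Qed.

Lemma dist_ge2 x y : (1 < dist g x y) = (x != y) && ~~ g x y.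
Proof. by rewrite -dist_eq0 -dist_eq1; case: dist => [|[]]. Qed.

Lemma dist_step k x y : dist g x y = k.+1 -> exists2 z, g x z & dist g z y = k.
Proof.
move=> dk; have /andP[] := walkn_dist x y; rewrite dk => /walknS[z gz /dist_le le] _.
exists z => //; apply/eqP; rewrite eqn_leq le /=.
by have := dist_adj_le y gz; rewrite dk.
Qed.

Lemma dist_eq2 x y z : x != y -> ~~ g x y -> g x z -> g y z -> dist g x y = 2.
Proof.
move=> nxy ngxy gxz gyz; apply/eqP; rewrite eqn_leq dist_ge2 nxy ngxy.
have := dist_triangle x z y; rewrite (dist_adj gxz) (distC z y) (dist_adj gyz). by rewrite !andbT.
Qed.

Lemma dist2_neighbour x y : x != y -> ~~ g x y -> dist g x y <= 2 ->
  exists2 z, g x z & g y z.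
Proof.
move=> nxy ngxy le2; have /dist_step[z gxz /eqP] : dist g x y = 2.
  by apply/eqP; rewrite eqn_leq le2 dist_ge2 nxy.
by rewrite dist_eq1 => gzy; exists z; rewrite // gsym.
Qed.

Definition good s :=
  forall u v, u \in s -> v \in s -> g u v ->
  exists2 w, w \notin s & dist g u w != dist g v w.

Lemma adj_separates s u v w : u \in s -> v \in s -> w \notin s ->
  g u w != g v w -> dist g u w != dist g v w.
Proof. by move=> us vs ws; apply: contraNneq => e; rewrite -!dist_eq1 e. Qed.

(** Good sets are the complements of local resolving sets, and subsets of good sets are good, since
    shrinking only adds distinguishing vertices. Hence any [k] vertices outside a minimum resolving
    set will do. *)
Lemma ldim_le k : k <= #|T| ->
  ldim g <= #|T| - k <-> exists s, [/\ uniq s, size s = k & good s].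
Proof.
move=> kn; rewrite /ldim; case: arg_minnP.
  by apply/forallP=> u; apply/forallP=> v; rewrite inE.
move=> W resW minW; split=> [leW | [s [us ss gs]]].
  exists (take k (enum (~: W))); split.
  - exact/take_uniq/enum_uniq.
  - by rewrite size_takel // -cardE cardsCs setCK leq_subRL ?max_card // addnC -leq_subRL.
  move=> u v /mem_take; rewrite mem_enum inE => uW /mem_take; rewrite mem_enum inE => vW guv.
  move/forallP: resW => /(_ u)/forallP/(_ v); rewrite uW vW guv /=.
  case/existsP=> w /andP[wW dw]; exists w => //.
  by apply/negP => /mem_take; rewrite mem_enum inE wW.
pose W' := ~: [set x in s].
have cW' : #|W'| = #|T| - k.
  by rewrite cardsCs setCK cardsE (card_uniqP us) ss.
rewrite -cW'; apply: minW; apply/forallP=> u; apply/forallP=> v.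
rewrite !inE !negbK; apply/implyP=> /and3P[uS vS guv].
have [w ws dw] := gs u v uS vS guv.
by apply/existsP; exists w; rewrite !inE ws.
Qed.

(** * Soundness of the search *)

Section Search.
Variables (x0 : T) (b : bool) (q : nat).
Hypothesis diam2 : forall x y, x != y -> ~~ g x y -> exists2 z, g x z & g y z.
Hypothesis nonedge_off : forall x y, b || (x == y) ->
  exists u v, [/\ u != v, ~~ g u v, u \notin [:: x; y] & v \notin [:: x; y]].
Hypothesis nogood : forall s, uniq s -> size s = q -> ~ good s.

Definition realizes (xs : seq T) M :=
  [/\ uniq xs, size xs = size M
    & forall i j, i < size xs -> j < size xs -> g (nth x0 xs i) (nth x0 xs j) = adj M i j].

Lemma realizes_rcons xs M w : realizes xs M -> w \notin xs ->
  realizes (rcons xs w) (rcons M [seq g w x | x <- xs]).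
Proof.
case=> uxs sxs gM wxs; split; rewrite ?rcons_uniq ?wxs ?size_rcons ?sxs //.
move=> i j; rewrite /adj !nth_rcons -sxs !ltnS => ile jle.
have gw k : k < size xs -> nth false [seq g w x | x <- xs] k = g w (nth x0 xs k).
  by move=> kl; rewrite (nth_map x0).
move: ile jle; rewrite [i <= _]leq_eqVlt [j <= _]leq_eqVlt.
case: (ltngtP i (size xs)) => //= hi _; case: (ltngtP j (size xs)) => //= hj _.
- by rewrite gM // /adj; case: ltngtP.
- by rewrite hj hi ltnNge (ltnW hi) /= gsym gw.
- by rewrite hi hj gw.
- by rewrite hi hj ltnn girr.
Qed.

(** The indices found name [q] vertices of [g] forming a good list, which [nogood] excludes. *)
Lemma has_resolved_sound xs M : has_resolved q M -> ~ realizes xs M.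
Proof.
rewrite /has_resolved lazy_hasE => /hasP[s /combsP[subs sizes]].
rewrite /resolved lazy_hasE => nh [uxs sxs gM].
have lt i : i \in s -> i < size xs.
  by move/(mem_subseq subs); rewrite mem_iota sxs.
have nthI : {in gtn (size xs) &, injective (nth x0 xs)}.
  by move=> i j il jl /eqP; rewrite nth_uniq // => /eqP.
apply: (@nogood (map (nth x0 xs) s)); last 1 first.
- move=> _ _ /mapP[i si ->] /mapP[j sj ->]; rewrite gM ?lt // => aij.
  move: nh; rewrite -all_predC => /allP/(_ i si) /=.
  rewrite lazy_hasE -all_predC => /allP/(_ j sj) /=.
  rewrite /unresolved aij negbK lazy_hasE => /hasP[k].
  rewrite mem_iota /= add0n -sxs => kl /andP[ks ak].
  have kN : nth x0 xs k \notin map (nth x0 xs) s.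
    by apply/mapP=> -[l sl /nthI E]; move: ks; rewrite E ?sl // inE lt.
  exists (nth x0 xs k) => //.
  by apply: (adj_separates _ _ kN); rewrite ?map_f // (gM i k) ?(gM j k) ?kl ?(lt i si) ?(lt j sj).
- rewrite map_inj_in_uniq; last by move=> i j si sj; apply: nthI; rewrite inE lt.
  exact: subseq_uniq subs (iota_uniq _ _).
- by rewrite size_map.
Qed.

Lemma is_C5_sound xs M : is_C5 M -> realizes xs M -> #|T| <= 5 -> isomorphic C5 g.
Proof.
case/andP=> /eqP sM /hasP[l]; rewrite mem_permutations => pl /allP lab [uxs sxs gM] T5.
have xsE : forall x, x \in xs.
  move=> x; have /subset_cardP : #|mem xs| = #|T|.
    by apply/eqP; rewrite eqn_leq max_card (card_uniqP uxs) sxs sM.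
  by move/(_ (subset_predT _)) => /(_ x).
have sl : size l = 5 by rewrite (perm_size pl).
have ll i : i < 5 -> nth 0 l i < size xs.
  by move=> il; rewrite sxs sM; have := mem_nth 0 (s := l) (n := i);
     rewrite sl (perm_mem pl) mem_iota; apply.
exists (fun i : 'I_5 => nth x0 xs (nth 0 l i)); split; last first.
  move=> i j; rewrite gM ?ll //; have := lab i; rewrite mem_iota ltn_ord => /(_ isT).
  by move=> /allP/(_ (val j)); rewrite mem_iota ltn_ord => /(_ isT)/eqP.
apply: inj_card_bij => [i j /eqP|]; last by rewrite card_ord.
by rewrite !nth_uniq ?ll ?sl // ?(perm_uniq pl) ?iota_uniq // => /eqP/val_inj.
Qed.

(** By induction on the fuel: at each branching the hypotheses provide actual new vertices of [g],
    so one of the extensions tried is again realized. Only a graph that is exactly C5 escapes. *)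
Lemma search_sound fuel xs M : search b q fuel M -> realizes xs M -> isomorphic C5 g.
Proof.
elim: fuel xs M => [|fuel IH] xs M /=.
  by case: ifP => // /has_resolved_sound h _ /h.
case: ifP => [/has_resolved_sound h _ /h // | _].
case Dd: [seq _ <- _ | _] => [|p d].
  case Dc: [seq _ <- _ | _] => [|p c].
    case: ifP => // C5M /allP ext rM.
    (* Either the five vertices are the whole graph, or a sixth one exists and all its possible rows
       are tried. *)
    have [T5 | T5] := leqP #|T| 5; first exact: is_C5_sound C5M rM T5.
    case: (rM) => uxs sxs _; case/andP: C5M => /eqP sM _.
    have [w wxs] : exists w, w \notin xs by apply: ex_notin; rewrite sxs sM.
    apply: IH (realizes_rcons rM wxs); apply: ext; apply: map_f.
    by rewrite -sxs -(size_map (g w)) mem_bitseqs.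
  have: p \in p :: c by rewrite mem_head.
  rewrite -Dc mem_filter => /andP[/andP[/eqP pb /allP cov]].
  case/allpairsPdep=> i [j []]; rewrite !mem_iota /= !add0n => il jl pE.
  move/allP=> ext rM; case: (rM) => uxs sxs gM.
  have {}jl : j < size M := leq_trans jl il.
  have hb : b || (nth x0 xs i == nth x0 xs j).
    by rewrite pb pE /= nth_uniq ?sxs //; case: eqP.
  have [u [v [nuv nguv ux vx]]] := nonedge_off hb.
  have memE w k : k < size xs -> w = nth x0 xs k ->
      w \notin [:: nth x0 xs i; nth x0 xs j] -> off_pair p k.
    move=> kl -> ; rewrite pE /off_pair /= !inE !nth_uniq ?sxs // -?sxs //.
    by rewrite negb_or.
  (* Both ends cannot lie in [xs], where all pairs off [p] are adjacent; by symmetry [u] is the new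
     one. *)
  wlog uxs' : u v nuv nguv ux vx / u \notin xs.
    move=> W; have [uin | unin] := boolP (u \in xs); last exact: (W u v).
    have [vin | vnin] := boolP (v \in xs); last first.
      by apply: (W v u) => //; [rewrite eq_sym | rewrite gsym].
    have ku : index u xs < size xs by rewrite index_mem.
    have kv : index v xs < size xs by rewrite index_mem.
    have := cov (index u xs); rewrite mem_iota -sxs => /(_ ku) /allP/(_ (index v xs)).
    rewrite mem_iota => /(_ kv); rewrite (memE u) ?nth_index // (memE v) ?nth_index //=.
    rewrite -gM // !nth_index // (negPf nguv) implybF negbK => /eqP iuv.
    by move: nuv; rewrite -[u](nth_index x0 uin) iuv nth_index // eqxx.
  have ru := realizes_rcons rM uxs'.
  have bu : [seq g u x | x <- xs] \in bitseqs (size M).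
    by rewrite -sxs -(size_map (g u)) mem_bitseqs.
  have [full | nfull] := boolP (all (fun i => off_pair p i ==>
      nth false [seq g u x | x <- xs] i) (iota 0 (size M))); last first.
    apply: IH ru; apply: ext; apply/flattenP; exists [:: rcons M [seq g u x | x <- xs]].
      by apply/mapP; exists [seq g u x | x <- xs]; rewrite ?(negPf nfull).
    exact: mem_head.
  (* Here [u] is adjacent to every listed vertex off [p], so its non-neighbour [v] is new too. *)
  have vxs : v \notin rcons xs u.
    rewrite mem_rcons inE eq_sym negb_or nuv; apply/negP => vin.
    have kv : index v xs < size xs by rewrite index_mem.
    move/allP: full => /(_ (index v xs)); rewrite mem_iota -sxs => /(_ kv).
    by rewrite (memE v) ?nth_index // (nth_map x0) // nth_index // (negPf nguv).
  apply: IH (realizes_rcons ru vxs); apply: ext; apply/flattenP.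
  exists [seq rcons (rcons M [seq g u x | x <- xs]) (rcons m false) | m <- bitseqs (size M)].
    by apply/mapP; exists [seq g u x | x <- xs]; rewrite ?full.
  apply/mapP; exists [seq g v x | x <- xs].
    by rewrite -sxs -(size_map (g v)) mem_bitseqs.
  by rewrite map_rcons gsym (negPf nguv).
have: p \in p :: d by rewrite mem_head.
rewrite -Dd mem_filter => /andP[/and3P[np nap nhas]].
case/allpairsPdep=> i [j []]; rewrite !mem_iota /= !add0n => il jl pE.
move/allP=> ext rM; case: (rM) => uxs sxs gM.
have {}jl : j < size M := leq_trans jl il.
move: np nap nhas ext; rewrite pE /= => np nap nhas ext.
have [||w giw gjw] := @diam2 (nth x0 xs i) (nth x0 xs j).
- by rewrite nth_uniq ?sxs.
- by rewrite gM ?sxs.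
have wxs : w \notin xs.
  apply: contra nhas => wxs; apply/hasP; exists (index w xs).
    by rewrite mem_iota -sxs index_mem.
  by rewrite -!gM ?sxs // -?sxs ?index_mem // nth_index // giw gjw.
apply: IH (realizes_rcons rM wxs); apply: ext; apply: map_f; rewrite mem_filter.
by rewrite !(nth_map x0) ?sxs // !(gsym w) giw gjw -sxs -(size_map (g w)) mem_bitseqs.
Qed.

End Search.

(** * Complete graphs with a deleted biclique *)

Definition deleted_biclique (A B : {set T}) := forall x y,
  g x y = (x != y) && ~~ ((x \in A) && (y \in B) || (x \in B) && (y \in A)).

Lemma Kminus_iso (x0 : T) (A B : {set T}) : [disjoint A & B] -> deleted_biclique A B ->
  isomorphic (Kminus #|T| #|A| #|B|) g.
Proof.
(* The vertices are listed as [A], then [B], then the rest, matching the index ranges in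
   [Kminus]. *)
move=> dAB gE; pose L := enum A ++ enum B ++ enum (~: (A :|: B)).
have allL x : x \in L.
  by rewrite !mem_cat !mem_enum !inE; case: (x \in A); case: (x \in B).
have sL : size L = #|T|.
  rewrite !size_cat -!cardE addnA.
  have -> : #|A| + #|B| = #|A :|: B| by apply/esym/eqP; rewrite (leq_card_setU A B).2.
  exact: cardsC.
have uL : uniq L by apply/card_uniqP; rewrite sL; apply: eq_card => x; rewrite !inE allL.
have inAB i : i < size L -> (nth x0 L i \in A) = (i < #|A|) /\
    (nth x0 L i \in B) = (#|A| <= i < #|A| + #|B|).
  rewrite !size_cat -!cardE => iL; rewrite !nth_cat -!cardE.
  have [iA | Ai] := ltnP i #|A|.
    have inA : nth x0 (enum A) i \in A by rewrite -mem_enum mem_nth -?cardE.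
    by rewrite inA (disjointFr dAB inA).
  rewrite ltn_subLR //; have [iB | Bi] := ltnP i (#|A| + #|B|).
    have inB : nth x0 (enum B) (i - #|A|) \in B.
      by rewrite -mem_enum mem_nth -?cardE // ltn_subLR.
    by rewrite inB (disjointFl dAB inB).
  have : nth x0 (enum (~: (A :|: B))) (i - #|A| - #|B|) \in ~: (A :|: B).
    by rewrite -mem_enum mem_nth // -cardE -subnDA ltn_subLR // -addnA.
  by rewrite !inE negb_or => /andP[/negPf-> /negPf->].
exists (fun i : 'I_#|T| => nth x0 L i); split.
  apply: inj_card_bij => [i j /eqP|]; last by rewrite card_ord.
  by rewrite nth_uniq ?sL // => /eqP/val_inj.
move=> i j; have [|iA iB] := inAB i; first by rewrite sL.
have [|jA jB] := inAB j; first by rewrite sL.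
by rewrite gE /Kminus iA iB jA jB nth_uniq ?sL.
Qed.

(** * Vertices at distance at least three *)

Lemma has_level x y k : k <= dist g y x -> exists v, dist g v x = k.
Proof.
move dy: (dist g y x) => l; elim: l y dy => [|l IHl] y dy.
  by rewrite leqn0 => /eqP->; exists y.
rewrite leq_eqVlt => /predU1P[-> | kl]; first by exists y.
by have [z _ dz] := dist_step dy; apply: (IHl z).
Qed.

Lemma levels_good x s : {in s &, injective (fun v => dist g v x)} ->
  all (fun v => dist g v x != 0) s -> good s.
Proof.
move=> inj nz u v us vs guv; exists x.
  by apply/negP => /(allP nz); rewrite distxx.
by apply: contraTneq guv => /inj -> //; rewrite girr.
Qed.

Lemma far_good x y k : k <= dist g y x -> exists s, [/\ uniq s, size s = k & good s].
Proof.
(* The guard [i <= k] makes the existence true for every [i], so that [xchoose] yields a total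
   choice of level representatives. *)
move=> kd; have lev i : exists v, (i <= k) ==> (dist g v x == i).
  have [ik | ] := boolP (i <= k); last by exists x.
  by have [v dv] := has_level (leq_trans ik kd); exists v; rewrite dv eqxx.
pose f i := xchoose (lev i).
have fE i : i <= k -> dist g (f i) x = i.
  by move=> ik; apply/eqP/(implyP (xchooseP (lev i))).
have iE i : i \in iota 1 k -> dist g (f i) x = i.
  by rewrite mem_iota add1n ltnS => /andP[_]; apply: fE.
exists (map f (iota 1 k)); split.
- rewrite map_inj_in_uniq ?iota_uniq // => i j ik jk fij.
  by have := iE i ik; rewrite fij iE.
- by rewrite size_map size_iota.
apply: (@levels_good x) => [_ _ /mapP[i ik ->] /mapP[j jk ->] | ].
  by rewrite !iE // => ->.
by apply/allP=> _ /mapP[i ik ->]; rewrite iE //; case: i ik => //; rewrite mem_iota.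
Qed.

Definition separated s u v := g u v -> exists2 w, w \notin s & dist g u w != dist g v w.

Lemma separated_sym s u v : separated s u v -> separated s v u.
Proof. by move=> suv; rewrite /separated gsym => /suv[w ws d]; exists w; rewrite // eq_sym. Qed.

Lemma good_pairwise s : (forall i j, i < j < size s ->
  forall x0, separated s (nth x0 s i) (nth x0 s j)) -> good s.
Proof.
move=> sep u v us vs guv.
have iu := nth_index u us; have iv := nth_index u vs.
case: (ltngtP (index u s) (index v s)) => uv.
- have := sep (index u s) (index v s) _ u; rewrite iu iv uv index_mem vs.
  by apply.
- have := sep (index v s) (index u s) _ u; rewrite iu iv uv index_mem us.
  by move=> /(_ isT)/separated_sym; apply.
- by move: guv; rewrite -iu uv iv girr.
Qed.

Lemma good3P x y z : let s := [:: x; y; z] in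
  separated s x y -> separated s x z -> separated s y z -> good s.
Proof.
by move=> s xy xz yz; apply: good_pairwise => [[|[|[|i]]] [|[|[|j]]]] // /andP[].
Qed.

Lemma good4P x y z t : let s := [:: x; y; z; t] in
  separated s x y -> separated s x z -> separated s x t ->
  separated s y z -> separated s y t -> separated s z t -> good s.
Proof.
by move=> s xy xz xt yz yt zt; apply: good_pairwise => [[|[|[|[|i]]]] [|[|[|[|j]]]]] // /andP[].
Qed.

Lemma separated_adj s u v w : u \in s -> v \in s -> w \notin s -> g u w != g v w ->
  separated s u v.
Proof. by move=> us vs ws d _; exists w => //; apply: (adj_separates us vs). Qed.

Lemma separated_nonadj s u v : ~~ g u v -> separated s u v.
Proof. by move=> /negP nguv /nguv. Qed.

Section Diameter.
Hypothesis nogood4 : forall s, uniq s -> size s = 4 -> ~ good s.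
Hypothesis nonedge_off2 : forall x y,
  exists u v, [/\ u != v, ~~ g u v, u \notin [:: x; y] & v \notin [:: x; y]].

Lemma dist_le3 x y : dist g x y <= 3.
Proof.
by rewrite leqNgt; apply/negP => /far_good[s [us ss gs]]; apply: (nogood4 us ss).
Qed.

Lemma dist_diff_nonadj x y z : dist g y x + 1 < dist g z x -> ~~ g y z.
Proof.
move=> lt; apply: contraL lt => gyz; rewrite -leqNgt addn1.
by apply: dist_adj_le; rewrite gsym.
Qed.

(** The vertex [a] distinguishes all pairs on different levels and lies outside the list. Only [x]
    and [x'] share a level, so separating them would complete a good 4-set. *)
Lemma two_on_level a x x' y z : x != x' -> dist g x a = dist g x' a ->
  uniq [:: 0; dist g x a; dist g y a; dist g z a] ->
  ~ separated [:: x; x'; y; z] x x'.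
Proof.
move=> nxx' dxx' /= /and4P[]; rewrite !inE !negb_or => /and3P[x0 y0 z0] /andP[xy xz] yz _ sep.
have lev (u v : T) : dist g u a != dist g v a -> (u == v) = false.
  by move=> d; apply: contraNF d => /eqP->.
have a_out : a \notin [:: x; x'; y; z].
  by rewrite !inE !negb_or -!dist_gt0 !(distC a) -dxx' !lt0n !(eq_sym _ 0) x0 y0 z0.
have sl u v : dist g u a != dist g v a -> separated [:: x; x'; y; z] u v.
  by move=> d _; exists a.
apply: (@nogood4 [:: x; x'; y; z]) => //.
  by rewrite /= !inE !negb_or nxx' !lev // -?dxx'.
by apply: good4P => //; apply: sl; rewrite -?dxx'.
Qed.

Section DiameterThree.
Variables (a d : T).
Hypothesis da : dist g d a = 3.

Let level k : k <= 3 -> exists v, dist g v a = k.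
Proof. by rewrite -da; apply: has_level. Qed.

(* Otherwise [u], [v] and representatives of the other two levels form a good 4-set. *)
Lemma level_clique u v : u != v -> dist g u a = dist g v a -> g u v.
Proof.
move=> nuv duv; apply/negPn/negP => /separated_nonadj sep.
have [l1 d1] := level (isT : 1 <= 3); have [l2 d2] := level (isT : 2 <= 3).
have := dist_le3 u a; move du: (dist g u a) => k.
case: k du => [|[|[|[|k]]]] // du _.
- by move: nuv; move/eqP: du; rewrite dist_eq0 => /eqP ua; move: duv;
     rewrite ua distxx => /esym/eqP; rewrite dist_eq0 => /eqP->; rewrite eqxx.
- by apply: (@two_on_level a u v l2 d); rewrite // du d2 da.
- by apply: (@two_on_level a u v l1 d); rewrite // du d1 da.
- by apply: (@two_on_level a u v l1 l2); rewrite // du d1 d2.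
Qed.

(** A second vertex [d'] at distance 3 would make [a], [b], [c], [d], taken from the four levels
    along a path through [b] and [c], a good set: [d'] separates [a] from [b] and [b] from [c], and
    a second vertex [b'] of level 1 separates [c] from [d]. *)
Lemma last_level_unique d' : dist g d' a = 3 -> d' = d.
Proof.
move=> d'a; apply/eqP/negPn/negP => nd'd.
have other e : exists2 e', e' != e & dist g e' a = 3.
  have [-> | ne] := eqVneq e d; first by exists d'.
  by exists d; rewrite // eq_sym.
(* If [c] and [e] were non-adjacent, [e] would separate [c] from a neighbour [c0] of [e] on the same
   level, while [e'] still represents level 3. *)
have complete c e : dist g c a = 2 -> dist g e a = 3 -> g c e.
  move=> dc de; have [c0 gec0 dc0] := dist_step de.
  have [-> | nc] := eqVneq c c0; first by rewrite gsym.
  apply/negPn/negP => nce; have [e' ne' de'] := other e.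
  have [b db] := level (isT : 1 <= 3).
  have lev x y : dist g x a != dist g y a -> x != y by apply: contraNneq => ->.
  apply: (@two_on_level a c c0 b e'); rewrite ?dc ?dc0 ?db ?de' //.
  apply: (@separated_adj _ _ _ e); rewrite ?mem_head ?inE ?eqxx ?orbT //.
    by rewrite !negb_or (eq_sym e e') ne' !lev // ?dc ?dc0 ?db de.
  by rewrite (negPf nce) gsym gec0.
have [c dc] := level (isT : 2 <= 3).
have [b gcb db] := dist_step dc.
(* A non-edge avoiding [a] and [b] has an end on level 1, since levels 2 and 3 together form a
   clique. *)
have [b' nb' db'] : exists2 b', b' != b & dist g b' a = 1.
  have [u [v []]] := nonedge_off2 a b; rewrite !inE !negb_or.
  move=> nuv nguv /andP[ua ub] /andP[va vb].
  have [du1 | du1] := eqVneq (dist g u a) 1; first by exists u.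
  have [dv1 | dv1] := eqVneq (dist g v a) 1; first by exists v.
  case/negP: nguv; have [duv | nduv] := eqVneq (dist g u a) (dist g v a).
    exact: level_clique.
  move: ua va du1 dv1 nduv (dist_le3 u a) (dist_le3 v a); rewrite -!dist_gt0.
  case du: (dist g u a) => [|[|[|[|]]]] //; case dv: (dist g v a) => [|[|[|[|]]]] // _ _ _ _ _ _ _.
    exact: complete.
  by rewrite gsym; apply: complete.
have lev x y : dist g x a != dist g y a -> x != y by apply: contraNneq => ->.
have nbd e x : dist g x a = 3 -> dist g e a = 1 -> ~~ g e x.
  by move=> dx de; apply: (@dist_diff_nonadj a); rewrite dx de.
have da0 := distxx a.
apply: (@nogood4 [:: a; b; c; d]) => //.
  by rewrite /= !inE !negb_or !lev // ?da0 ?db ?dc ?da.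
have d'_out : d' \notin [:: a; b; c; d].
  by rewrite !inE !negb_or nd'd !lev // ?d'a ?da0 ?db ?dc.
have bd' : dist g b d' <= 2.
  by rewrite -(dist_adj (complete c d' dc d'a)) dist_adj_le // gsym.
apply: good4P.
- by move=> _; exists d' => //; rewrite distC d'a neq_ltn ltnS bd' orbT.
- by apply: separated_nonadj; rewrite gsym -dist_eq1 dc.
- by apply: separated_nonadj; rewrite gsym -dist_eq1 da.
- apply: (separated_adj _ _ d'_out); rewrite ?inE ?eqxx ?orbT //.
  by rewrite (negPf (nbd _ _ d'a db)) complete.
- by apply: separated_nonadj; apply: nbd.
have b'_out : b' \notin [:: a; b; c; d].
  by rewrite !inE !negb_or nb' !lev // ?da0 ?db' ?dc ?da.
have [gb'c | ngb'c] := boolP (g b' c).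
  apply: (separated_adj _ _ b'_out); rewrite ?inE ?eqxx ?orbT //.
  by rewrite gsym gb'c gsym (negPf (nbd _ _ da db')).
(* If [c] and [d] were equally far from [b'], both at distance 2, then [d] and [b'] would have a
   common neighbour [e] on level 2; [b], [b'], [e], [d] would contradict [two_on_level], as [c]
   separates [b] from [b']. *)
move=> _; exists b' => //; apply/negP => /eqP eqd.
have gbb' : g b' b by apply: level_clique; rewrite ?db.
have dcb' : dist g c b' = 2.
  by apply: (dist_eq2 _ _ gcb gbb'); rewrite ?lev ?dc ?db' // gsym.
have [e gde deb'] : exists2 e, g d e & dist g e b' = 1 by apply: dist_step; rewrite -eqd.
have geb' : g e b' by rewrite -dist_eq1 deb'.
have de : dist g e a = 2.
  have := dist_adj_le a gde; have := dist_adj_le a geb'; rewrite db' da.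
  by case: (dist g e a) => [|[|[|]]].
apply: (@two_on_level a b b' e d); rewrite ?db ?db' ?de ?da //; first by rewrite eq_sym.
apply: (@separated_adj _ _ _ c); rewrite ?inE ?eqxx ?orbT //.
  rewrite !negb_or; apply/and4P; split; try by rewrite lev ?dc ?db ?db' ?da.
  by apply: contraNneq ngb'c => ->; rewrite gsym.
by rewrite gsym gcb (negPf ngb'c).
Qed.

End DiameterThree.

(** Uniqueness of the last level, seen from [a] and from [d], puts all other vertices at distance 1
    or 2 from both. A non-edge avoiding [a] and [d] must then join types (1,2) and (2,1), and
    [levels_adj] excludes this. *)
Lemma no_distance_three a d : dist g d a <> 3.
Proof.
move=> da; have ad : dist g a d = 3 by rewrite distC.
have [u [v [nuv nguv]]] := nonedge_off2 a d.
rewrite !inE !negb_or => /andP[ua ud] /andP[va vd].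
have mid w : w != a -> w != d -> 0 < dist g w a < 3 /\ 0 < dist g w d < 3.
  move=> wa wd; rewrite !dist_gt0 wa wd !ltn_neqAle !dist_le3 !andbT; split.
    by apply: contraNneq wd => /(last_level_unique da)->.
  by apply: contraNneq wa => /(last_level_unique ad)->.
have levels_adj w z : dist g w a = 1 -> dist g w d = 2 -> dist g z a = 2 -> dist g z d = 1 -> g w z.
  move=> wa wd za zd; apply/negPn/negP => nwz.
  (* The list [a], [w], [z], [d] would be good: [c] separates [a] from [w], [b] separates [z] from
     [d], and all other pairs are non-adjacent. *)
  have [c gwc cd] := dist_step wd; have [b gzb ba] := dist_step za.
  have ne x y e : dist g x e != dist g y e -> x != y by apply: contraNneq => ->.
  have nac : ~~ g a c by rewrite gsym; apply: (@dist_diff_nonadj d); rewrite cd ad.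
  have nbd : ~~ g b d by apply: (@dist_diff_nonadj a); rewrite ba da.
  have c_out : c \notin [:: a; w; z; d].
    rewrite !inE !negb_or (ne c a d) ?(ne c w d) ?(ne c d d) ?distxx ?cd ?ad ?wd // andbT.
    by apply: contraNneq nwz => <-.
  have b_out : b \notin [:: a; w; z; d].
    rewrite !inE !negb_or (ne b a a) ?(ne b z a) ?(ne b d a) ?distxx ?ba ?da ?za //.
    by rewrite /= andbT; apply: contraNneq nwz => <-; rewrite gsym.
  apply: (@nogood4 [:: a; w; z; d]) => //.
    by rewrite /= !inE !negb_or !(ne _ _ a) ?distxx ?wa ?za ?da.
  apply: good4P.
  - apply: (separated_adj _ _ c_out); rewrite ?inE ?eqxx ?orbT //.
    by rewrite gwc (negPf nac).
  - by apply: separated_nonadj; rewrite gsym -dist_eq1 za.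
  - by apply: separated_nonadj; rewrite gsym -dist_eq1 da.
  - exact: separated_nonadj.
  - by apply: separated_nonadj; rewrite -dist_eq1 wd.
  apply: (separated_adj _ _ b_out); rewrite ?inE ?eqxx ?orbT //.
  by rewrite gzb gsym (negPf nbd).
case/negP: nguv.
have [eqa | neqa] := eqVneq (dist g u a) (dist g v a); first by apply: (level_clique da).
have [eqd | neqd] := eqVneq (dist g u d) (dist g v d); first by apply: (level_clique ad).
(* One of [u], [v] is next to [a] and the other next to [d]. *)
have := dist_triangle a u d; have := dist_triangle a v d.
rewrite ad !(distC a); have [ua12 ud12] := mid u ua ud; have [va12 vd12] := mid v va vd.
case ua1: (dist g u a) ua12 neqa => [|[|[|]]] // _;
case ud1: (dist g u d) ud12 neqd => [|[|[|]]] // _;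
case va1: (dist g v a) va12 => [|[|[|]]] // _;
case vd1: (dist g v d) vd12 => [|[|[|]]] // _ _ _ _ _.
  exact: levels_adj.
by rewrite gsym; apply: levels_adj.
Qed.

(** * Diameter two *)

Lemma common_neighbour x y : x != y -> ~~ g x y -> exists2 z, g x z & g y z.
Proof.
move=> nxy ngxy; apply: dist2_neighbour => //.
by have := dist_le3 x y; rewrite leq_eqVlt => /predU1P[/no_distance_three|].
Qed.

Hypothesis notC5 : ~ isomorphic C5 g.

Lemma no_realization x0 xs M fuel : search true 4 fuel M -> ~ realizes x0 xs M.
Proof.
move=> sM rM; apply: notC5; apply: search_sound sM rM => //.
exact: common_neighbour.
Qed.

Lemma no_independent3 x y z : uniq [:: x; y; z] -> ~~ g x y -> ~~ g x z -> g y z.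
Proof.
move=> uxyz /negPf nxy /negPf nxz; apply/negPn/negP => /negPf nyz.
apply: (@no_realization x [:: x; y; z] _ _ search_3K1); split=> //.
by move=> [|[|[|i]]] [|[|[|j]]] //= _ _; rewrite ?girr // ?(gsym y x) ?(gsym z) ?nxy ?nxz ?nyz.
Qed.

Lemma no_path4 x y z t : uniq [:: x; y; z; t] -> g x y -> g y z -> g z t ->
  ~~ g x z -> ~~ g y t -> g x t.
Proof.
move=> uxyz xy yz zt /negPf xz /negPf yt; apply/negPn/negP => /negPf xt.
apply: (@no_realization x [:: x; y; z; t] _ _ search_P4); split=> //.
by move=> [|[|[|[|i]]]] [|[|[|[|j]]]] //= _ _; rewrite ?girr // ?(gsym y x) ?(gsym z x)
  ?(gsym z y) ?(gsym t) ?xy ?yz ?zt ?xz ?yt ?xt.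
Qed.

Lemma no_cycle4 x y z t : uniq [:: x; y; z; t] -> g x y -> g y z -> g z t ->
  g t x -> ~~ g x z -> g y t.
Proof.
move=> uxyz xy yz zt tx /negPf xz; apply/negPn/negP => /negPf yt.
apply: (@no_realization x [:: x; y; z; t] _ _ search_C4); split=> //.
by move=> [|[|[|[|i]]]] [|[|[|[|j]]]] //= _ _; rewrite ?girr // ?(gsym x t) ?(gsym y x) ?(gsym z x)
  ?(gsym z y) ?(gsym t y) ?(gsym t z) ?xy ?yz ?zt ?xz ?yt ?tx.
Qed.

(** Without 3K1, [A] and [B] are disjoint cliques. Without P4, no edge joins them and every vertex
    outside both is joined to both; without C4 the outside vertices form a clique. *)
Lemma biclique_partition a b : a != b -> ~~ g a b ->
  let A := [set v | (v != b) && ~~ g v b] in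
  let B := [set v | (v != a) && ~~ g v a] in
  [disjoint A & B] /\ deleted_biclique A B.
Proof.
move=> nab ngab A B.
have inA v : (v \in A) = (v != b) && ~~ g v b by rewrite inE.
have inB v : (v \in B) = (v != a) && ~~ g v a by rewrite inE.
have aA : a \in A by rewrite inA nab.
have bB : b \in B by rewrite inB eq_sym nab gsym.
have AB x : x \in A -> x \in B -> false.
  rewrite inA inB => /andP[xb gxb] /andP[xa gxa]; rewrite -(negPf ngab).
  by apply: (@no_independent3 x); rewrite //= !inE negb_or xa xb nab.
have AA x y : x \in A -> y \in A -> x != y -> g x y.
  rewrite !inA => /andP[xb gxb] /andP[yb gyb] nxy.
  by apply: (@no_independent3 b); rewrite ?(gsym b) //= !inE negb_or nxy !(eq_sym b) xb yb.
have BB x y : x \in B -> y \in B -> x != y -> g x y.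
  rewrite !inB => /andP[xa gxa] /andP[ya gya] nxy.
  by apply: (@no_independent3 a); rewrite ?(gsym a) //= !inE negb_or nxy !(eq_sym a) xa ya.
have gA x : x \notin A -> x != b -> g x b by rewrite inA negb_and !negbK; case: eqP.
have gB x : x \notin B -> x != a -> g x a by rewrite inB negb_and !negbK; case: eqP.
have nAB x y : x \in A -> y \in B -> g x y = false.
  move=> xA yB; apply/negP => gxy.
  have yA : y \notin A by apply/negP => /AB/(_ yB).
  have xB : x \notin B by apply/negP => /(AB x xA).
  move: (xA) (yB); rewrite inA inB => /andP[xb gxb] /andP[ya gya].
  have xa : x != a by apply: contraNneq gya => <-; rewrite gsym.
  have yb : y != b by apply: contraNneq gxb => <-.
  (* An edge [x y] between the two sides would make [a x y b] an induced path. *)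
  case/negP: ngab; apply: (@no_path4 a x y b) => //; last by rewrite gsym.
  - rewrite /= !inE !negb_or !(eq_sym a) xa ya (eq_sym b) nab xb yb.
    by rewrite (contraTneq _ gxy) // => ->; rewrite girr.
  - by rewrite gsym gB.
  - exact: gA.
have CX x : x \notin A -> x \notin B -> [/\ x != a, x != b, g x a & g x b].
  move=> xA xB; have xa : x != a by apply: contraNneq xA => ->.
  have xb : x != b by apply: contraNneq xB => ->.
  by rewrite xa xb gA // gB.
have CA x y : x \notin A -> x \notin B -> y \in A -> g x y.
  move=> xA xB yA; have [xa xb gxa gxb] := CX x xA xB.
  have [-> // | ya] := eqVneq y a; have nxy : x != y by apply: contraNneq xA => ->.
  move: (yA); rewrite inA => /andP[yb gyb].
  apply/negPn/negP => ngxy; case/negP: gyb; apply: (@no_path4 y a x b) => //.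
  - by rewrite /= !inE !negb_or ya yb eq_sym nxy (eq_sym a) xa nab xb.
  - exact: AA.
  - by rewrite gsym.
  - by rewrite gsym.
have CB x y : x \notin A -> x \notin B -> y \in B -> g x y.
  move=> xA xB yB; have [xa xb gxa gxb] := CX x xA xB.
  have [-> // | yb] := eqVneq y b; have nxy : x != y by apply: contraNneq xB => ->.
  move: (yB); rewrite inB => /andP[ya gya].
  apply/negPn/negP => ngxy; case/negP: gya; apply: (@no_path4 y b x a) => //.
  - by rewrite /= !inE !negb_or ya yb eq_sym nxy (eq_sym b) xb (eq_sym b) nab xa.
  - exact: BB.
  - by rewrite gsym.
  - by rewrite gsym.
  - by rewrite gsym.
have CC x y : x \notin A -> x \notin B -> y \notin A -> y \notin B -> x != y -> g x y.
  move=> xA xB yA yB nxy; have [xa xb gxa gxb] := CX x xA xB.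
  have [ya yb gya gyb] := CX y yA yB.
  apply: (@no_cycle4 a x b y); rewrite // 1?gsym //.
  by rewrite /= !inE !negb_or !(eq_sym a) xa ya eq_sym nab xb nxy (eq_sym b) yb.
split; first by rewrite disjoint_subset; apply/subsetP=> x /AB h; apply/negP => /h.
move=> x y; have [-> | nxy] := eqVneq x y; first by rewrite girr.
have notB z : z \in A -> z \in B = false by move=> zA; apply/negP => /(AB z zA).
have [xA | xA] := boolP (x \in A).
  have [yA | yA] := boolP (y \in A); first by rewrite !notB // AA.
  have [yB | yB] := boolP (y \in B); first by rewrite nAB.
  by rewrite gsym CA // notB.
have [xB | xB] := boolP (x \in B).
  have [yA | yA] := boolP (y \in A); first by rewrite gsym nAB.
  have [yB | yB] := boolP (y \in B); first by rewrite BB.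
  by rewrite gsym CB.
have [yA | yA] := boolP (y \in A); first by rewrite CA.
have [yB | yB] := boolP (y \in B); first by rewrite CB.
by rewrite CC.
Qed.

(** Every non-edge has an end in [B], and every vertex is avoided by some non-edge, so no single
    vertex exhausts [B]. *)
Lemma deleted_biclique_large (x0 : T) (A B : {set T}) : deleted_biclique A B -> 1 < #|B|.
Proof.
move=> gE; have pickB x : exists2 u, u \in B & u != x.
  have [u [v [nuv]]] := nonedge_off2 x x; rewrite !inE !orbb gE nuv negbK.
  by move=> /orP[/andP[_ vB] _ vx | /andP[uB _] ux _]; [exists v | exists u].
have [u uB _] := pickB x0; have [v vB nvu] := pickB u.
by apply/card_gt1P; exists v, u.
Qed.

Lemma deleted_biclique_sym (A B : {set T}) : deleted_biclique A B -> deleted_biclique B A.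
Proof. by move=> gE x y; rewrite gE orbC. Qed.

Lemma Kminus_of_nonedge a b : a != b -> ~~ g a b ->
  exists lam mu, [/\ 2 <= mu, mu <= lam, lam + mu < #|T| & isomorphic (Kminus #|T| lam mu) g].
Proof.
move=> nab ngab; have [] := biclique_partition nab ngab.
set A := [set v | _ & ~~ g v b]; set B := [set v | _ & _] => dAB gE.
(* The common neighbour [z] lies in neither class, which makes the bound on [lam + mu] strict. *)
have [z gaz gbz] := common_neighbour nab ngab.
have ltT : #|A| + #|B| < #|T|.
  have -> : #|A| + #|B| = #|A :|: B| by apply/esym/eqP; rewrite (leq_card_setU A B).2.
  rewrite -cardsT; apply/proper_card/properP; split; first exact: subsetT.
  by exists z; rewrite ?inE // !(gsym z) gaz gbz !andbF.
have [leBA | /ltnW leAB] := leqP #|B| #|A|.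
  exists #|A|, #|B|; split=> //; first exact: deleted_biclique_large gE.
  exact: Kminus_iso.
exists #|B|, #|A|; split=> //; rewrite 1?addnC //.
  exact: deleted_biclique_large (deleted_biclique_sym gE).
by apply: Kminus_iso => //; [rewrite disjoint_sym | exact: deleted_biclique_sym].
Qed.

End Diameter.

(** * Good sets in the extremal graphs *)

(** The second vertex of a shortest path from [v] to [w] is [u] or a neighbour of [u], so [u] is no
    farther from [w] than [v] is; the converse is symmetric. *)
Lemma twin_dist u v w : (forall z, z != u -> z != v -> g u z = g v z) ->
  w != u -> w != v -> dist g u w = dist g v w.
Proof.
have le u' v' : (forall z, z != u' -> z != v' -> g u' z = g v' z) ->
    w != u' -> w != v' -> dist g u' w <= dist g v' w.
  move=> tw wu wv; move dv: (dist g v' w) => [|k].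
    by move/eqP: dv; rewrite dist_eq0 eq_sym (negPf wv).
  have [z gvz dz] := dist_step dv; have [zu | zu] := eqVneq z u'.
    by rewrite -zu dz.
  have zv : z != v' by apply: contraTneq gvz => ->; rewrite girr.
  by rewrite -dz dist_adj_le // tw.
move=> tw wu wv; apply/eqP; rewrite eqn_leq !le // => z zv zu.
by rewrite tw.
Qed.

(** Of three consecutive vertices, the two remaining ones separate the adjacent pairs. Four vertices
    omit only one, and both ends of the edge opposite to it are at distance 2 from it. *)
Lemma C5_good : isomorphic C5 g ->
  (exists s, [/\ uniq s, size s = 3 & good s]) /\
  (forall s, uniq s -> size s = 4 -> ~ good s).
Proof.
case=> f [bf fE]; pose F k := f (inord k).
pose adj5 i j := (j == (i + 1) %% 5) || (i == (j + 1) %% 5).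
have gF i j : i < 5 -> j < 5 -> g (F i) (F j) = adj5 i j.
  by move=> i5 j5; rewrite fE /C5 !inordK.
have Feq i j : i < 5 -> j < 5 -> (F i == F j) = (i == j).
  by move=> i5 j5; rewrite (bij_eq bf) -val_eqE /= !inordK.
have cT : #|T| = 5 by rewrite -(bij_eq_card bf) card_ord.
split=> [|s us ss gs].
  exists [:: F 2; F 3; F 4]; split=> //; first by rewrite /= !inE !Feq.
  apply: good3P.
  - by apply: (@separated_adj _ _ _ (F 1)); rewrite ?inE ?gF ?Feq ?eqxx ?orbT.
  - by apply: separated_nonadj; rewrite gF.
  - by apply: (@separated_adj _ _ _ (F 0)); rewrite ?inE ?gF ?Feq ?eqxx ?orbT.
have [x xs] : exists x, x \notin s by apply: ex_notin; rewrite ss cT.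
have outE w : w \notin s -> w = x.
  move=> ws; apply/eqP; apply: contraT => nwx.
  have /card_uniqP cu : uniq [:: w, x & s] by rewrite /= inE negb_or nwx ws xs.
  by have := max_card (mem [:: w, x & s]); rewrite cu /= ss cT.
(* Here [k] is the omitted vertex, [u v] the opposite edge, and [r], [t] link [u], [v] to [k]. *)
have H (k u v r t : nat) : x = F k -> [&& k < 5, u < 5, v < 5, r < 5 & t < 5] ->
    [&& adj5 u v, adj5 u r, adj5 k r, adj5 v t & adj5 k t] ->
    [&& ~~ adj5 u k, ~~ adj5 v k, u != k & v != k] -> False.
  move=> xF /and5P[k5 u5 v5 r5 t5] /and5P[uv ur kr vt kt] /and4P[nuk nvk euk evk].
  have ins j : j < 5 -> j != k -> F j \in s.
    by move=> j5; apply: contraR => /outE/eqP; rewrite xF Feq.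
  have du : dist g (F u) (F k) = 2 by apply: (@dist_eq2 _ _ (F r)); rewrite ?gF ?Feq.
  have dv : dist g (F v) (F k) = 2 by apply: (@dist_eq2 _ _ (F t)); rewrite ?gF ?Feq.
  have [||| w /outE-> ] := gs (F u) (F v); rewrite ?ins ?gF //.
  by rewrite xF du dv.
have [h fK hK] := bf.
have : x = F (h x) by rewrite /F inord_val hK.
case: (h x) => [[|[|[|[|[|//]]]]] _] /= xF.
- exact: (H 0 2 3 1 4).
- exact: (H 1 3 4 2 0).
- exact: (H 2 4 0 3 1).
- exact: (H 3 0 1 4 2).
- exact: (H 4 1 2 0 3).
Qed.

(** One vertex from each of the three classes is a good set, as second vertices of the two deleted
    sides separate them. Among four vertices two share a class, and these are adjacent twins. *)
Lemma Kminus_good lam mu : 2 <= mu -> mu <= lam -> lam + mu < #|T| ->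
    isomorphic (Kminus #|T| lam mu) g ->
  (exists s, [/\ uniq s, size s = 3 & good s]) /\
  (forall s, uniq s -> size s = 4 -> ~ good s).
Proof.
move=> mu2 mulam lt [f [bf fE]]; have [h fK hK] := bf.
pose part (x : T) := if h x < lam then 0 else if h x < lam + mu then 1 else 2.
have gE x y : g x y = (x != y) &&
    ~~ ((part x == 0) && (part y == 1) || (part x == 1) && (part y == 0)).
  rewrite -{1}(hK x) -{1}(hK y) fE /Kminus (can_eq hK) /part.
  by case: (ltnP (h x) lam) => _; case: (ltnP (h y) lam) => _ //;
     case: (h x < _); case: (h y < _).
split=> [|s us ss gs].
  have lt0 : 0 < #|T| by apply: leq_ltn_trans lt.
  pose F k := f (insubd (Ordinal lt0) k).
  have hF k : k < #|T| -> h (F k) = k :> nat by move=> kT; rewrite fK insubdK.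
  have Fne i j : i < #|T| -> j < #|T| -> i != j -> F i != F j.
    by move=> iT jT; apply: contraNneq => Fij; rewrite -(hF i) // Fij hF.
  have partF k : k < #|T| -> part (F k) = if k < lam then 0 else if k < lam + mu then 1 else 2.
    by move=> kT; rewrite /part hF.
  have lamT : lam + 1 < #|T| by apply: leq_ltn_trans lt; rewrite leq_add2l ltnW.
  have [lam0 lam1] : 0 < lam /\ 1 < lam by split; [apply: ltnW|]; apply: leq_trans mulam.
  have lamT' : lam < #|T| by apply: leq_ltn_trans lamT; rewrite addn1.
  have T1 : 1 < #|T| by apply: ltn_trans lamT'.
  have mu0 : 0 < mu by apply: ltnW.
  have p0 : part (F 0) = 0 by rewrite partF // lam0.
  have p1 : part (F 1) = 0 by rewrite partF // lam1.
  have pB : part (F lam) = 1 by rewrite partF // ltnn -addn1 leq_add2l mu0.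
  have pB' : part (F (lam + 1)) = 1 by rewrite partF // ltn_add2l mu2 ltnNge leq_addr.
  have pC : part (F (lam + mu)) = 2 by rewrite partF // ltnn ltnNge leq_addr.
  have ne u v : part u != part v -> u != v by apply: contraNneq => ->.
  have ne01 : F 1 != F 0 by apply: Fne.
  have neB : F (lam + 1) != F lam by apply: Fne; rewrite // addn1 neq_ltn ltnSn orbT.
  exists [:: F 0; F lam; F (lam + mu)]; split=> //.
    by rewrite /= !inE !negb_or !ne ?p0 ?pB ?pC.
  apply: good3P.
  - by apply: separated_nonadj; rewrite gE p0 pB andbF.
  - apply: (@separated_adj _ _ _ (F (lam + 1))); rewrite ?inE ?eqxx ?orbT //.
      by rewrite !negb_or neB !ne ?p0 ?pB' ?pC.
    by rewrite !gE p0 pB' pC !ne ?pB' ?pC ?p0.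
  - apply: (@separated_adj _ _ _ (F 1)); rewrite ?inE ?eqxx ?orbT //.
      by rewrite !negb_or ne01 !ne ?p1 ?pB ?pC.
    by rewrite !gE p1 pB pC !ne ?p1 ?pC ?pB.
have part_inj : {in s &, injective part}.
  move=> u v su sv puv; apply/eqP; apply: contraT => nuv.
  have [|w ws /eqP[]] := gs u v su sv.
    by rewrite gE nuv puv; case: (part v) => [|[]].
  apply: twin_dist => [z zu zv||].
  - by rewrite !gE puv !(eq_sym _ z) zu zv.
  - by apply: contraNneq ws => ->.
  - by apply: contraNneq ws => ->.
have sub : {subset map part s <= [:: 0; 1; 2]}.
  by move=> _ /mapP[u _ ->]; rewrite /part !inE; case: ifP => // _; case: ifP.
have := uniq_leq_size _ sub; rewrite map_inj_in_uniq // us size_map ss.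
by move/(_ isT).
Qed.

(** * Cliques and good sets *)

Lemma is_cliqueP (K : {set T}) :
  reflect {in K &, forall x y, x != y -> g x y} (is_clique g K).
Proof.
apply: (iffP forall_inP) => [cK x y xK yK nxy | cK x xK].
  by have /forall_inP/(_ y yK)/implyP := cK x xK; apply.
by apply/forall_inP=> y yK; apply/implyP; apply: cK.
Qed.

Lemma leq_omega (K : {set T}) : is_clique g K -> #|K| <= omega g.
Proof. by move=> cK; apply: (bigmax_sup K). Qed.

Lemma omega_witness : exists2 K : {set T}, is_clique g K & #|K| = omega g.
Proof.
have c0 : is_clique g set0 by apply/is_cliqueP=> x y; rewrite inE.
have [K cK ->] : {K | is_clique g K & omega g = #|K|}.
  by apply: eq_bigmax_cond; apply/card_gt0P; exists set0.
by exists K.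
Qed.

Lemma nonedge_in (K : {set T}) : omega g < #|K| ->
  exists u v, [/\ u \in K, v \in K, u != v & ~~ g u v].
Proof.
rewrite ltnNge => /negP om; have : ~~ is_clique g K by apply/negP => /leq_omega.
case/forall_inPn=> u uK /forall_inPn[v vK]; rewrite negb_imply => /andP[nuv nguv].
by exists u, v.
Qed.

Lemma nonedge_off_set (D : {set T}) : omega g < #|T| - #|D| ->
  exists u v, [/\ u != v, ~~ g u v, u \notin D & v \notin D].
Proof.
move=> om; have [|u [v [uD vD nuv nguv]]] := @nonedge_in (~: D).
  by rewrite cardsCs setCK.
by exists u, v; rewrite -!in_setC.
Qed.

Section Clique.
Variables (K : {set T}) (cK : is_clique g K).

Definition odd_from (s : seq T) k := [set w in ~: K :\: [set x in s] | odd (dist g k w)].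

(* The distances of two adjacent vertices to [w] differ by at most one, so they agree
   as soon as their parities do. *)
Lemma odd_from_inj s : good s -> {in [set x in s] :&: K &, injective (odd_from s)}.
Proof.
move=> gs u v; rewrite !inE => /andP[us uK] /andP[vs vK] /setP eqo.
apply/eqP; apply: contraT => nuv; have guv := is_cliqueP _ cK u v uK vK nuv.
have [w ws /eqP[]] := gs u v us vs guv.
(* A clique vertex outside [s] is at distance 1 from both [u] and [v], so the distinguishing vertex
   is outside [K]. *)
have [wK | wK] := boolP (w \in K).
  have d1 x : x \in s -> x \in K -> dist g x w = 1.
    move=> xs xK; apply/dist_adj/(is_cliqueP _ cK) => //.
    by apply: contraNneq ws => <-.
  by rewrite !d1.
have := eqo w; rewrite !inE ws wK /= => odd_eq.
have := dist_adj_le w guv; have gvu : g v u by rewrite gsym.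
have := dist_adj_le w gvu; move: odd_eq.
lia.
Qed.

(** The members of [s] in [K] have distinct parity sets, all of them subsets of the vertices outside
    both [K] and [s]. *)
Lemma good_clique_bound s : uniq s -> good s ->
  size s - #|[set x in s] :\: K| <= 2 ^ (#|~: K| - #|[set x in s] :\: K|).
Proof.
move=> us gs; have cs : #|[set x in s]| = size s by rewrite cardsE (card_uniqP us).
have -> : size s - #|[set x in s] :\: K| = #|[set x in s] :&: K|.
  by rewrite -cs -(cardsID K) addnK.
have -> : #|~: K| - #|[set x in s] :\: K| = #|~: K :\: [set x in s]|.
  rewrite -(cardsID [set x in s] (~: K)) addnC.
  by rewrite (_ : ~: K :&: [set x in s] = [set x in s] :\: K) ?addnK // setDE setIC.
rewrite -card_powerset -(card_in_imset (odd_from_inj gs)).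
apply/subset_leq_card/subsetP=> _ /imsetP[k _ ->]; rewrite inE.
by apply/subsetP=> w; rewrite inE => /andP[].
Qed.

End Clique.

Lemma good3_omega s : uniq s -> size s = 3 -> good s -> omega g <= #|T| - 2.
Proof.
move=> us ss gs; have [K cK cKo] := omega_witness.
have := good_clique_bound cK us gs; rewrite ss -cKo; have := cardsC K.
have := max_card (mem s); rewrite (card_uniqP us) ss.
have : #|[set x in s] :\: K| <= #|~: K| by rewrite setDE subset_leq_card // subsetIr.
move: (#|_ :\: K|) => j; move: #|~: K| => c.
(* With [j] members of [s] outside the clique, [3 - j <= 2 ^ (c - j)] fails for all
   [j <= c <= 1]. *)
case: c => [|[|c]]; case: j => [|[|[|[|j]]]]; rewrite ?expn0 ?expn1; lia.
Qed.

(** * The graphs [Gamma1] and [Gamma2] *)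

(** The vertices play v_1, ..., v_6 in order. The pair [x], [y] is left free, which covers both
    graphs at once. *)
Definition gamma_pattern (p q r t x y : T) :=
  [&& uniq [:: p; q; r; t; x; y],
      [&& g p q, g p r, g p t, g q r, g q t & g r t],
      [&& g p x, g q x, ~~ g r x & ~~ g t x] &
      [&& g p y, ~~ g q y, g r y & ~~ g t y]].

(** The four clique vertices have the four different adjacency patterns to [x] and [y]. *)
Lemma gamma_good p q r t x y : gamma_pattern p q r t x y -> good [:: p; q; r; t].
Proof.
case/and4P=> u _ /and4P[px qx /negPf rx /negPf tx] /and4P[py /negPf qy ry /negPf ty].
move: u; rewrite (cat_uniq [:: p; q; r; t] [:: x; y]) => /and3P[_ + _].
rewrite /= orbF negb_or => /andP[x_out y_out].
apply: good4P.
- by apply: (separated_adj _ _ y_out); rewrite ?inE ?eqxx ?orbT // py qy.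
- by apply: (separated_adj _ _ x_out); rewrite ?inE ?eqxx ?orbT // px rx.
- by apply: (separated_adj _ _ x_out); rewrite ?inE ?eqxx ?orbT // px tx.
- by apply: (separated_adj _ _ x_out); rewrite ?inE ?eqxx ?orbT // qx rx.
- by apply: (separated_adj _ _ x_out); rewrite ?inE ?eqxx ?orbT // qx tx.
- by apply: (separated_adj _ _ y_out); rewrite ?inE ?eqxx ?orbT // ry ty.
Qed.

Lemma gamma_patternP :
  (exists p q r t x y, gamma_pattern p q r t x y) <->
  induced_sub Gamma1 g \/ induced_sub Gamma2 g.
Proof.
split=> [[p [q [r [t [x [y]]]]]] | ].
  case/and4P=> u /and5P[pq pr pt qr /andP[qt rt]] /and4P[px qx /negPf rx /negPf tx].
  case/and4P=> py /negPf qy ry /negPf ty.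
  pose f (i : 'I_6) := nth p [:: p; q; r; t; x; y] i.
  have f_inj : injective f.
    by move=> i j /eqP; rewrite nth_uniq // => /eqP/val_inj.
  have sym := (gsym q p, gsym r p, gsym t p, gsym x p, gsym y p, gsym r q, gsym t q, gsym x q,
    gsym y q, gsym t r, gsym x r, gsym y r, gsym x t, gsym y t, gsym y x).
  case xy: (g x y); [right | left]; exists f; split=> //.
    by move=> [[|[|[|[|[|[|//]]]]]] ?] [[|[|[|[|[|[|//]]]]]] ?]; rewrite /f /= ?girr //;
      rewrite ?(pq, pr, pt, qr, qt, rt, px, qx, rx, tx, py, qy, ry, ty, xy) ?sym
        ?(pq, pr, pt, qr, qt, rt, px, qx, rx, tx, py, qy, ry, ty, xy).
  by move=> [[|[|[|[|[|[|//]]]]]] ?] [[|[|[|[|[|[|//]]]]]] ?]; rewrite /f /= ?girr //;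
      rewrite ?(pq, pr, pt, qr, qt, rt, px, qx, rx, tx, py, qy, ry, ty, xy) ?sym
        ?(pq, pr, pt, qr, qt, rt, px, qx, rx, tx, py, qy, ry, ty, xy).
have pat h : (h =2 Gamma1 \/ h =2 Gamma2) -> induced_sub h g ->
    exists p q r t x y, gamma_pattern p q r t x y.
  move=> hG [f [f_inj fE]]; pose o k := f (inord k).
  exists (o 0), (o 1), (o 2), (o 3), (o 4), (o 5).
  rewrite /gamma_pattern (map_inj_uniq f_inj (map inord (iota 0 6))).
  rewrite !fE.
  by case: hG => hE; rewrite !hE /Gamma1 /Gamma2 /= !inE -!val_eqE /= !inordK.
by case=> /pat; apply; [left | right].
Qed.

(** Through [k0], all clique vertices are within distance 2 of [x], where odd means adjacent. *)
Lemma odd_dist_clique (K : {set T}) x k0 : is_clique g K -> x \notin K ->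
  k0 \in K -> g k0 x -> {in K, forall k, odd (dist g k x) = g k x}.
Proof.
move=> cK xK k0K gk0 k kK; have kx : k != x by apply: contraNneq xK => <-.
have le2 : dist g k x <= 2.
  have [-> | nkk0] := eqVneq k k0; first by rewrite dist_adj.
  by rewrite -[2]/(1.+1) -(dist_adj gk0) dist_adj_le // (is_cliqueP _ cK).
by move: kx le2; rewrite -dist_gt0 -dist_eq1; case: (dist g k x) => [|[|[|]]].
Qed.

(* If [x] is outside the clique and has no neighbour in it, every path to [x] goes through [y]. *)
Lemma odd_dist_far (K : {set T}) x y : ~: K = [set x; y] ->
  {in K, forall k, ~~ g k x} ->
  {in K, forall k, odd (dist g k x) = ~~ odd (dist g k y)}.
Proof.
move=> KC nx k kK; have xK : x \notin K by rewrite -in_setC KC !inE eqxx.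
case dk: (dist g x k) => [|m].
  by move/eqP: dk; rewrite dist_eq0 => /eqP xk; rewrite xk kK in xK.
have [z gxz dz] := dist_step dk.
have : z \in ~: K.
  by rewrite inE; apply: contraL gxz => /nx; rewrite gsym.
rewrite KC !inE; case/orP=> [/eqP zx | /eqP <-]; first by rewrite zx girr in gxz.
by rewrite (distC k x) dk (distC k z) dz.
Qed.

Lemma gamma_of_good (K : {set T}) s : 2 <= #|T| -> is_clique g K -> #|K| = #|T| - 2 ->
  uniq s -> size s = 4 -> good s -> exists p q r t x y, gamma_pattern p q r t x y.
Proof.
move=> T2 cK cardK us ss gs.
have cardKC : #|~: K| = 2 by rewrite cardsCs setCK cardK subKn.
pose S := [set x in s]; have cS : #|S| = 4 by rewrite cardsE (card_uniqP us).
(* The inequality [4 - j <= 2 ^ (2 - j)] leaves only [j = 0]. *)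
have SK : S :\: K = set0.
  apply/eqP; rewrite -cards_eq0.
  have := good_clique_bound cK us gs; rewrite ss cardKC.
  have : #|S :\: K| <= #|~: K| by rewrite setDE subset_leq_card // subsetIr.
  by rewrite cardKC -/S; case: #|_ :\: K| => [|[|[|]]].
have {}SK : S \subset K by rewrite -setD_eq0 SK.
have /cards2P[x [y [nxy KC]]] : #|~: K| == 2 by rewrite cardKC.
(* Four distinct parity sets exhaust the four subsets of the pair outside [K]. *)
have onto (R : {set T}) : R \subset [set x; y] -> exists2 k, k \in K & odd_from K s k = R.
  rewrite -KC => RK; have imE : odd_from K s @: S = powerset (~: K).
    apply/eqP; rewrite eqEcard card_powerset cardKC card_in_imset ?cS // ?leqnn ?andbT.
      apply/subsetP=> _ /imsetP[k _ ->]; rewrite inE; apply/subsetP=> w.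
      by rewrite !inE => /andP[/andP[]].
    by have := odd_from_inj cK gs; rewrite (setIidPl SK).
  have : R \in odd_from K s @: S by rewrite imE inE.
  by case/imsetP=> k /(subsetP SK) kK ->; exists k.
have oddE k w : w \in ~: K -> (w \in odd_from K s k) = odd (dist g k w).
  move=> wK; rewrite !inE -in_setC wK andbT; case: (w \in s) / boolP => // ws.
  by have := subsetP SK w; rewrite inE ws => /(_ isT); rewrite -[w \in K]negbK -in_setC wK.
have [xK yK] : x \in ~: K /\ y \in ~: K by rewrite KC !inE !eqxx orbT.
have both : exists2 k, k \in K & odd (dist g k x) && odd (dist g k y).
  have [k kK kR] := onto _ (subxx [set x; y]); exists k => //.
  by rewrite -!oddE // kR -KC xK yK.
have [p0 p0K /andP[p0x p0y]] := both.
(* The vertex [p0] is at odd distance from both outer vertices; if [z] had no neighbour in [K],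
   these parities would be opposite. *)
have odd_adj z z' : ~: K = [set z; z'] -> odd (dist g p0 z) && odd (dist g p0 z') ->
    {in K, forall k, odd (dist g k z) = g k z}.
  move=> KC' /andP[oz oz']; have [/exists_inP[k kK gkz] | ] := boolP [exists k in K, g k z].
    by apply: (odd_dist_clique cK _ kK gkz); rewrite -in_setC KC' !inE eqxx.
  rewrite negb_exists_in => /forall_inP nz.
  by have := odd_dist_far KC' nz p0K; rewrite oz oz'.
have oddx := odd_adj x y KC (introT andP (conj p0x p0y)).
have KC' : ~: K = [set y; x] by rewrite setUC.
have oddy := odd_adj y x KC' (introT andP (conj p0y p0x)).
have pick bx by' : exists2 k, k \in K & (g k x == bx) && (g k y == by').
  have [|k kK kR] := onto [set w in ~: K | (w == x) && bx || (w == y) && by'].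
    by rewrite -KC; apply/subsetP=> w; rewrite inE => /andP[].
  exists k => //; rewrite -oddx // -oddy // -!oddE // kR !inE -!in_setC xK yK !eqxx.
  by rewrite (eq_sym y x) (negPf nxy) orbF !eqxx.
have [p pK /andP[/eqP px /eqP py]] := pick true true.
have [q qK /andP[/eqP qx /eqP qy]] := pick true false.
have [r rK /andP[/eqP rx /eqP ry]] := pick false true.
have [t tK /andP[/eqP tx /eqP ty]] := pick false false.
have nex u v : g u x != g v x -> u != v by apply: contraNneq => ->.
have ney u v : g u y != g v y -> u != v by apply: contraNneq => ->.
have [pq pr pt] : [/\ p != q, p != r & p != t].
  by split; [apply: ney; rewrite py qy | apply: nex; rewrite px rx | apply: nex; rewrite px tx].
have [qr qt rt] : [/\ q != r, q != t & r != t].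
  by split; [apply: nex; rewrite qx rx | apply: nex; rewrite qx tx | apply: ney; rewrite ry ty].
have neK k z : k \in K -> z \in ~: K -> k != z.
  by move=> kK zK; apply: contraTneq kK => ->; rewrite -in_setC.
exists p, q, r, t, x, y; rewrite /gamma_pattern /= !inE !negb_or px py qx qy rx ry tx ty.
by rewrite pq pr pt qr qt rt nxy !neK // !(is_cliqueP _ cK).
Qed.

(** * Existence of good 3-sets and the case distinction *)

Lemma good3_exists : 2 < #|T| -> omega g <= #|T| - 2 ->
  exists s, [/\ uniq s, size s = 3 & good s].
Proof.
(* As an inequality on [ldim], the existence is decidable and can be proved by contradiction. The
   search then leaves only C5, which does have a good 3-set. *)
move=> T3 om; apply/(ldim_le T3); apply: contraT => /negP nle.
have nogood3 s : uniq s -> size s = 3 -> ~ good s.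
  by move=> us ss gs; apply: nle; apply/(ldim_le T3); exists s.
have off x : exists u v, [/\ u != v, ~~ g u v, u \notin [set x] & v \notin [set x]].
  by apply: nonedge_off_set; rewrite cards1; lia.
have diam2 x y : x != y -> ~~ g x y -> exists2 z, g x z & g y z.
  move=> nxy ngxy; apply: dist2_neighbour => //; rewrite leqNgt; apply/negP => lt2.
  by have [s [us ss gs]] := far_good lt2; apply: (nogood3 s).
have [x0 _] : exists x0 : T, x0 \in T by apply/card_gt0P; apply: leq_trans T3.
have [u [v [nuv /negPf nguv _ _]]] := off x0.
have isoC5 : isomorphic C5 g.
  apply: (search_sound diam2 _ nogood3 search_nonedge (xs := [:: u; v]) (x0 := u)).
    move=> x y /= /eqP <-; have [w [z []]] := off x.
    by rewrite !inE; exists w, z; rewrite !inE !orbb.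
  split; rewrite /= ?inE ?nuv //.
  by move=> [|[|i]] [|[|j]] //= _ _; rewrite ?girr // ?(gsym v) nguv.
by have [[s [us ss gs]] _] := C5_good isoC5; case: (nogood3 s).
Qed.

(** Only finitely many maps need testing; injectivity and a cardinality bound replace bijectivity.
    This justifies the case split on C5. *)
Lemma isomorphic_dec (T' : finType) (h : rel T') : isomorphic h g \/ ~ isomorphic h g.
Proof.
pose iso (f : {ffun T' -> T}) :=
  [&& injectiveb f, #|T| <= #|T'| & [forall x, forall y, g (f x) (f y) == h x y]].
have [/existsP[f /and3P[/injectiveP f_inj le /forallP fE]] | nex] := boolP [exists f, iso f].
  left; exists f; split; first exact: inj_card_bij.
  by move=> x y; apply/eqP; move/forallP: (fE x).
right=> -[f [bf fE]]; case/negP: nex; apply/existsP; exists (finfun f).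
apply/and3P; split.
- by apply/injectiveP=> x y; rewrite !ffunE => /(bij_inj bf).
- by rewrite (bij_eq_card bf).
by apply/forallP=> x; apply/forallP=> y; rewrite !ffunE fE.
Qed.

Lemma small_clique_cases : 4 < #|T| -> omega g < #|T| - 2 ->
  (forall s, uniq s -> size s = 4 -> ~ good s) ->
  isomorphic C5 g \/ exists lam mu, [/\ 2 <= mu, mu <= lam, lam + mu < #|T|
    & isomorphic (Kminus #|T| lam mu) g].
Proof.
move=> T5 om nogood4; have [|nC5] := isomorphic_dec C5; [by left | right].
have off x y : exists u v, [/\ u != v, ~~ g u v, u \notin [:: x; y] & v \notin [:: x; y]].
  have [|u [v [nuv nguv]]] := @nonedge_off_set [set x; y].
    by rewrite cards2; case: (x != y); lia.
  by rewrite !in_set2 => ux vx; exists u, v; rewrite !inE.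
have [x0 _] : exists x0 : T, x0 \in T by apply/card_gt0P; apply: leq_trans T5.
by have [a [b [nab ngab _ _]]] := off x0 x0; apply: Kminus_of_nonedge nab ngab.
Qed.

Lemma ldim_eq : 4 < #|T| ->
  ldim g = #|T| - 3 <-> (exists s, [/\ uniq s, size s = 3 & good s]) /\
                        (forall s, uniq s -> size s = 4 -> ~ good s).
Proof.
move=> T5; have le3 := ldim_le (ltnW (ltnW T5)); have le4 := ldim_le (ltnW T5).
split=> [dimE | [/le3 le no4]].
  split; first by apply/le3; rewrite dimE.
  move=> s us ss gs; have /le4 : exists s, [/\ uniq s, size s = 4 & good s] by exists s.
  by rewrite dimE; lia.
have : ~ ldim g <= #|T| - 4 by move=> /le4[s [us ss gs]]; apply: (no4 s).
lia.
Qed.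

End Graph.

Theorem theorem2p4 (T : finType) (g : rel T) :
  simple_graph g -> connected_graph g -> 5 <= #|T| ->
  (ldim g = #|T| - 3 <->
     [\/ omega g = #|T| - 2 /\ ~ induced_sub Gamma1 g /\ ~ induced_sub Gamma2 g,
         isomorphic C5 g
       | exists lam mu : nat,
           [/\ 2 <= mu, mu <= lam, lam + mu < #|T| &
               isomorphic (Kminus #|T| lam mu) g]]).
Proof.
move=> [gsym girr] gconn T5; rewrite (ldim_eq g T5).
have gammaP := gamma_patternP gsym girr; split.
  move=> [[s3 [us3 ss3 gs3]] no4].
  (* A good 3-set bounds [omega]; equality gives the first alternative, strict inequality one of the
     other two. *)
  have := good3_omega gsym girr gconn us3 ss3 gs3; rewrite leq_eqVlt.
  case/orP=> [/eqP om | om]; last first.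
    have [isoC5 | isoK] := small_clique_cases gsym girr gconn T5 om no4.
      exact: Or32.
    exact: Or33.
  have no_gamma : ~ (induced_sub Gamma1 g \/ induced_sub Gamma2 g).
    move/gammaP=> [p [q [r [t [x [y pat]]]]]].
    apply: (no4 [:: p; q; r; t]) => //; last exact: gamma_good pat.
    by case/and4P: pat => u _ _ _; have := take_uniq 4 u.
  by apply: Or31; split=> //; split=> h; apply: no_gamma; [left | right].
case=> [[om [nG1 nG2]] | isoC5 | [lam [mu [mu2 mulam lt isoK]]]].
- split=> [|s us ss gs].
    by apply: good3_exists => //; [apply: ltn_trans T5 | rewrite om].
  have [K cK cardK] := omega_witness g; rewrite om in cardK.
  have T2 : 2 <= #|T| by apply: ltn_trans T5.
  by case/gammaP: (gamma_of_good gsym girr gconn T2 cK cardK us ss gs).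
- exact: C5_good isoC5.
- exact: Kminus_good isoK.
Qed.
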